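(* Let $\{x^k\}$ be a sequence generated by the feasible augmented Lagrangian method (Algorithm 3 described in the context) applied to the problem $$\min_{x\in\mathbb{R}^n}\{\Phi(x):\ \|Ax-b\|\le\sigma\},\qquad \Phi(x):=\sum_{i=r+1}^n\phi(|x|_{[i]}).$$ Suppose that $x^*$ is an accumulation point of $\{x^k\}$. Then: (i) $x^*$ is a feasible point of the problem, i.e. $\|Ax^*-b\|\le\sigma$. (ii) Suppose additionally that $\partial^\infty\Phi(x^* )\cap\mathcal C=\{0\}$, and that $A^T(Ax^*-b)\ne0$ if $\|Ax^*-b\|=\sigma$, where $\mathcal C:=\{tA^T(b-Ax^* ):t\ge0\}$. Then $x^*$ is a first-order stationary point of the problem, that is, there exists $\mu^*\ge0$ such that $$0\in2\mu^*A^T(Ax^*-b)+\partial\Phi(x^* ),\qquad\|Ax^*-b\|\le\sigma,\qquad\mu^*(\|Ax^*-b\|-\sigma)=0.$$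
   Context: Setting: $A\in\mathbb{R}^{m\times n}$, $b\in\mathbb{R}^m$, $\sigma\ge0$, $r\in\{0,\ldots,n-1\}$; $\phi:[0,\infty)\to\mathbb{R}$ is continuous and increasing (in the weak sense) with $\phi(0)=0$; $x^{\rm feas}$ is a point with $\|Ax^{\rm feas}-b\|\le\sigma$. $|x|_{[i]}$ is the $i$th largest element of $\{|x_1|,\ldots,|x_n|\}$; $\|\cdot\|$ is the Euclidean norm; $[t]_+=\max\{0,t\}$; $\mathrm{dist}(0,S)$ is the distance from $0$ to $S$. Subdifferentials: for a proper lower semi-continuous $\vartheta$, say $v\in\hat\partial\vartheta(y)$ if $\liminf_{z\to y}\frac{\vartheta(z)-\vartheta(y)-\langle v,z-y\rangle}{\|z-y\|}\ge0$. The limiting subdifferential $\partial\vartheta(x)$ is the set of $v$ for which there exist $y^k\to x$ with $\vartheta(y^k)\to\vartheta(x)$ and $v^k\in\hat\partial\vartheta(y^k)$ with $v^k\to v$. The horizon subdifferential $\partial^\infty\vartheta(x)$ is the set of $v$ for which there exist $y^k\to x$ with $\vartheta(y^k)\to\vartheta(x)$, $v^k\in\hat\partial\vartheta(y^k)$ and $\lambda_k>0$, $\lambda_k\to0$, with $\lambda_kv^k\to v$. Augmented Lagrangian: for $\varrho>0$, $\mu\ge0$, $\tilde w(x;\mu,\varrho):=\frac{1}{2\varrho}\big([\mu+\varrho(\|Ax-b\|^2-\sigma^2)]_+^2-\mu^2\big)$ and $\widetilde{\mathcal L}(x;\mu,\varrho):=\tilde w(x;\mu,\varrho)+\Phi(x)$.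 Algorithm 3. Choose $\mu_0\ge0$, $x^0\in\mathbb{R}^n$, $\varrho_0>0$, $\gamma\in(1,\infty)$, $\theta>0$, $\eta\in(0,1)$, a decreasing positive sequence $\{\epsilon_k\}$ with $\epsilon_k\to0$, and a constant $\Upsilon\ge\max\{\Phi(x^{\rm feas}),\widetilde{\mathcal L}(x^0;\mu_0,\varrho_0)\}$. Set $k=0$. 1) Find (by applying a proximal gradient method to $\min_x\widetilde{\mathcal L}(x;\mu_k,\varrho_k)$) an approximate stationary point $x^{k+1}$ such that $\mathrm{dist}(0,\nabla\tilde w(x^{k+1};\mu_k,\varrho_k)+\partial\Phi(x^{k+1}))\le\epsilon_k$ and $\widetilde{\mathcal L}(x^{k+1};\mu_k,\varrho_k)\le\Upsilon$, where $\nabla$ is with respect to $x$. 2) Set $\mu_{k+1}=[\mu_k+\varrho_k(\|Ax^{k+1}-b\|^2-\sigma^2)]_+$. 3) If $[\|Ax^{k+1}-b\|-\sigma]_+\le\eta[\|Ax^k-b\|-\sigma]_+$, set $\varrho_{k+1}=\varrho_k$; otherwise set $\varrho_{k+1}=\max\{\gamma\varrho_k,\mu_{k+1}^{1+\theta}\}$. 4) Set $k\leftarrow k+1$ and go to 1). The proximal gradient method in step 1) (a nonmonotone proximal gradient method) for $\min_x\{F(x)=\tilde w(x;\mu_k,\varrho_k)+\Phi(x)\}$ is started from $x^{\rm feas}$ if $\widetilde{\mathcal L}(x^k;\mu_k,\varrho_k)>\Upsilon$ and from $x^k$ otherwise. With fixed parameters $0<L_{\min}<L_{\max}$, $\tau>1$,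 $c>0$ and integer $N\ge0$, from inner iterate $y^j$ it takes $L=L^0_j\in[L_{\min},L_{\max}]$, computes $y^{j+1}\in\mathrm{Argmin}_y\{\nabla\tilde w(y^j;\mu_k,\varrho_k)^T(y-y^j)+\frac L2\|y-y^j\|^2+\Phi(y)\}$, and, until $F(y^{j+1})\le\max_{\max\{j-N,0\}\le i\le j}F(y^i)-\frac c2\|y^{j+1}-y^j\|^2$ holds, replaces $L$ by $\tau L$ and recomputes $y^{j+1}$; inner iterations stop at a point meeting the two requirements on $x^{k+1}$ in step 1). *)

(* Defs.v *)
From HB Require Import structures.
From mathcomp Require Import all_boot all_order all_algebra.
From mathcomp Require Import all_classical all_reals all_analysis.

Set Implicit Arguments.
Unset Strict Implicit.
Unset Printing Implicit Defensive.

Import Order.TTheory GRing.Theory Num.Theory.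
Import numFieldNormedType.Exports.

Local Open Scope classical_set_scope.
Local Open Scope ring_scope.

(* Vectors of R^n are columns.  The library norm [`|x|] on matrices is the sup
   norm, so the Euclidean norm is defined separately; the topology on ['cV[R]_n]
   (hence every convergence and neighbourhood below) is the usual one. *)
Definition dotp (R : realType) (n : nat) (u v : 'cV[R]_n) : R :=
  \sum_i u i 0 * v i 0.

Definition enorm (R : realType) (n : nat) (u : 'cV[R]_n) : R :=
  Num.sqrt (dotp u u).

Definition pospart (R : realType) (t : R) : R := Num.max 0 t.

(* dist(0, S), with value +oo when S is empty. *)
Definition dist0 (R : realType) (n : nat) (S : set 'cV[R]_n) : \bar R :=
  ereal_inf [set (enorm s)%:E | s in S].

Definition gradient (R : realType) (n : nat) (f : 'cV[R]_n -> R)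
    (x : 'cV[R]_n) : 'cV[R]_n :=
  \col_i 'D_(delta_mx i 0) f x.

Definition argmin (R : realType) (T : Type) (f : T -> R) : set T :=
  [set y | forall z, f y <= f z].

(* The i-th largest of |x_1|, ..., |x_n|, for 1 <= i <= n. *)
Definition abs_ord (R : realType) (n : nat) (x : 'cV[R]_n) (i : nat) : R :=
  nth 0 (sort >=%R [seq `|x j 0| | j <- enum 'I_n]) i.-1.

Definition Phi (R : realType) (n : nat) (phi : R -> R) (r : nat)
    (x : 'cV[R]_n) : R :=
  \sum_(r.+1 <= i < n.+1) phi (abs_ord x i).

(* Phi is finite everywhere, so the subdifferentials are defined for real-valued
   functions.  The deleted neighbourhood filter gives the liminf over z <> y. *)
Definition regular_subdiff (R : realType) (n : nat) (f : 'cV[R]_n -> R)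
    (y : 'cV[R]_n) : set 'cV[R]_n :=
  [set v | (0 <= limf_einf
     (fun z => ((f z - f y - dotp v (z - y)) / enorm (z - y))%:E) y^')%E].

Definition limiting_subdiff (R : realType) (n : nat) (f : 'cV[R]_n -> R)
    (x : 'cV[R]_n) : set 'cV[R]_n :=
  [set v | exists y w : nat -> 'cV[R]_n,
     [/\ y k @[k --> \oo] --> x,
         f (y k) @[k --> \oo] --> f x,
         forall k, regular_subdiff f (y k) (w k)
       & w k @[k --> \oo] --> v]].

Definition horizon_subdiff (R : realType) (n : nat) (f : 'cV[R]_n -> R)
    (x : 'cV[R]_n) : set 'cV[R]_n :=
  [set v | exists (y w : nat -> 'cV[R]_n) (lam : nat -> R),
     [/\ y k @[k --> \oo] --> x /\ f (y k) @[k --> \oo] --> f x,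
         forall k, regular_subdiff f (y k) (w k),
         forall k, 0 < lam k,
         lam k @[k --> \oo] --> 0
       & lam k *: w k @[k --> \oo] --> v]].

Definition wtilde (R : realType) (m n : nat) (A : 'M[R]_(m, n)) (b : 'cV[R]_m)
    (sigma mu rho : R) (x : 'cV[R]_n) : R :=
  (2 * rho)^-1 *
  (pospart (mu + rho * (enorm (A *m x - b) ^+ 2 - sigma ^+ 2)) ^+ 2 - mu ^+ 2).

Definition auglag (R : realType) (m n : nat) (A : 'M[R]_(m, n)) (b : 'cV[R]_m)
    (sigma : R) (P : 'cV[R]_n -> R) (mu rho : R) (x : 'cV[R]_n) : R :=
  wtilde A b sigma mu rho x + P x.

Definition prox_argmin (R : realType) (n : nat) (w P : 'cV[R]_n -> R) (L : R)
    (y : 'cV[R]_n) : set 'cV[R]_n :=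
  argmin (fun z => dotp (gradient w y) (z - y)
                   + L / 2 * enorm (z - y) ^+ 2 + P z).

(* The truncated subtraction [j - N] is max{j - N, 0}; the default value of
   the maximum is one of its terms. *)
Definition sufficient_decrease (R : realType) (n : nat) (F : 'cV[R]_n -> R)
    (c : R) (N : nat) (y : nat -> 'cV[R]_n) (j : nat) (u : 'cV[R]_n) : bool :=
  F u <= \big[Num.max/F (y j)]_((j - N)%N <= i < j.+1) F (y i)
         - c / 2 * enorm (u - y j) ^+ 2.

(* [u l] is the trial point computed after [l] increases of L; the first one
   passing the test is [u s]. *)
Definition npg_step (R : realType) (n : nat) (w P : 'cV[R]_n -> R)
    (Lmin Lmax tau c : R) (N : nat) (y : nat -> 'cV[R]_n) (j : nat) : Prop :=
  exists (L0 : R) (s : nat) (u : nat -> 'cV[R]_n),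
    let ok := sufficient_decrease (fun z => w z + P z) c N y j in
    [/\ Lmin <= L0 <= Lmax,
        forall l, (l <= s)%N -> prox_argmin w P (tau ^+ l * L0) (y j) (u l),
        forall l, (l < s)%N -> ~~ ok (u l),
        ok (u s)
      & y j.+1 = u s].

Definition npg_output (R : realType) (n : nat) (w P : 'cV[R]_n -> R)
    (Lmin Lmax tau c : R) (N : nat) (start out : 'cV[R]_n) : Prop :=
  exists (y : nat -> 'cV[R]_n) (J : nat),
    [/\ y 0%N = start,
        forall j, (j < J)%N -> npg_step w P Lmin Lmax tau c N y j
      & y J = out].

Definition falm_iteration (R : realType) (m n : nat) (A : 'M[R]_(m, n))
    (b : 'cV[R]_m) (sigma : R) (P : 'cV[R]_n -> R) (xfeas : 'cV[R]_n)
    (gamma theta eta : R) (eps : nat -> R) (Upsilon : R)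
    (Lmin Lmax tau c : R) (N : nat)
    (x : nat -> 'cV[R]_n) (mu rho : nat -> R) (k : nat) : Prop :=
  let w := wtilde A b sigma (mu k) (rho k) in
  let Lag := auglag A b sigma P (mu k) (rho k) in
  let start := if Upsilon < Lag (x k) then xfeas else x k in
  let viol z := pospart (enorm (A *m z - b) - sigma) in
  [/\ npg_output w P Lmin Lmax tau c N start (x k.+1),
      (dist0 [set (gradient w (x k.+1) + v)%R | v in limiting_subdiff P (x k.+1)]
         <= (eps k)%:E)%E,
      Lag (x k.+1) <= Upsilon,
      mu k.+1 = pospart (mu k
                  + rho k * (enorm (A *m x k.+1 - b) ^+ 2 - sigma ^+ 2))
    & rho k.+1 = if viol (x k.+1) <= eta * viol (x k) then rho k
                 else Num.max (gamma * rho k) (mu k.+1 `^ (1 + theta))].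

(* [x], [mu], [rho] are the sequences generated by the feasible augmented
   Lagrangian method; the initial data are [x 0], [mu 0] and [rho 0]. *)
Definition falm_generated (R : realType) (m n : nat) (A : 'M[R]_(m, n))
    (b : 'cV[R]_m) (sigma : R) (P : 'cV[R]_n -> R) (xfeas : 'cV[R]_n)
    (gamma theta eta : R) (eps : nat -> R) (Upsilon : R)
    (Lmin Lmax tau c : R) (N : nat)
    (x : nat -> 'cV[R]_n) (mu rho : nat -> R) : Prop :=
  [/\ 0 <= mu 0%N, 0 < rho 0%N,
      Num.max (P xfeas) (auglag A b sigma P (mu 0%N) (rho 0%N) (x 0%N))
        <= Upsilon
    & forall k, falm_iteration A b sigma P xfeas gamma theta eta eps Upsilon
                  Lmin Lmax tau c N x mu rho k].

Definition first_order_stationary (R : realType) (m n : nat)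
    (A : 'M[R]_(m, n)) (b : 'cV[R]_m) (sigma : R) (P : 'cV[R]_n -> R)
    (x : 'cV[R]_n) : Prop :=
  exists mus : R,
    [/\ 0 <= mus,
        [set (2 * mus) *: (A^T *m (A *m x - b)) + v
           | v in limiting_subdiff P x] 0,
        enorm (A *m x - b) <= sigma
      & mus * (enorm (A *m x - b) - sigma) = 0].

(* Main.v *)
Require Import Defs.
From mathcomp Require Import all_boot all_order all_algebra.
From mathcomp Require Import all_classical all_reals all_analysis.
From mathcomp Require Import ring lra.

Import Order.TTheory GRing.Theory Num.Theory.
Import numFieldNormedType.Exports.

Local Open Scope classical_set_scope.
Local Open Scope ring_scope.

Set Implicit Arguments.
Unset Strict Implicit.

(** The proof combines the scalar recursion of the multipliers and penalties
with the approximate stationarity of the iterates and the bound [Upsilon] on the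
augmented Lagrangian.  Write [e_k] for the residual norm
[enorm (A *m x k - b)] and [v_k = [e_k - sigma]_+] for the violation.

Feasibility.  As [Phi >= 0], the bound on the augmented Lagrangian at [x_(k+1)]
reads [2 mu_k d + rho_k d^2 <= 2 Upsilon] with [d = e_(k+1)^2 - sigma^2] when [d
>= 0], and [v_(k+1)^2 <= d], hence [v_(k+1)^4 <= 2 Upsilon / rho_k].  The
penalty is nondecreasing and grows at least by a factor [gamma] at each update,
so either [rho_k] tends to infinity, and this bound forces [v_k -> 0], or the
test [v_(k+1) <= eta v_k] holds from some point on, and [v_k] decays
geometrically ([run_violation_cvg0]).

Inactive constraint.  Let [q_k = mu_k / rho_k].  While the penalty is unchanged,
[q_k] grows by at most [v_(k+1) (v_(k+1) + 2 sigma)], which the geometric decay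
of [v] pays for: once [v_k <= 1], [q_k + C v_k] is nonincreasing for a suitable
constant [C] ([potential_nonincreasing]).  At a penalty update [rho >= mu^(1 +
theta)] makes [q] small once [rho] is large.  Hence [q_k] converges, to [0] if
the penalty is unbounded ([run_ratio_cvg]).  Along a subsequence with [e_(k+1)
-> l < sigma] the identity [mu_(k+1) = rho_k [q_k + d]_+], where [d -> l^2 -
sigma^2 < 0], then gives [mu_(k+1) = 0] eventually ([run_inactive_multiplier]).

Stationarity.  The gradient of the penalty term is
[2 mu_(k+1) A^T (A x_(k+1) - b)] ([gradient_wtilde]), so some subgradient [v^k]
of [Phi] at [x_(k+1)] satisfies [2 mu_(k+1) A^T (A x_(k+1) - b) + v^k -> 0].
[Phi] is continuous, because order statistics are 1-Lipschitz
([abs_ord_lipschitz]), so limits of (scaled) subgradients are limiting (horizon)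
subgradients.  If the constraint is inactive at the accumulation point, the
multipliers vanish and [0] is itself a subgradient.  If it is active, either a
subsequence of multipliers converges, which gives stationarity, or they tend to
infinity and dividing by them produces the horizon subgradient
[A^T (b - A x)] ([multiplier_dichotomy]); the latter is nonzero, which
contradicts the constraint qualification. *)

(** * One step of the multiplier update *)

Definition violation (R : realType) (sigma t : R) : R := pospart (t - sigma).

Lemma pospart_ge0 (R : realType) (t : R) : 0 <= pospart t.
Proof. by rewrite /pospart le_max lexx. Qed.

Lemma pospart_ge (R : realType) (t : R) : t <= pospart t.
Proof. by rewrite /pospart le_max lexx orbT. Qed.

Lemma pospart_id (R : realType) (t : R) : 0 <= t -> pospart t = t.
Proof. by move=> t0; rewrite /pospart max_r. Qed.

Lemma pospart_le0 (R : realType) (t : R) : t <= 0 -> pospart t = 0.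
Proof. by move=> t0; rewrite /pospart max_l. Qed.

Lemma pospart_continuous (R : realType) : continuous (@pospart R).
Proof.
move=> t; apply: (@continuous_max _ _ (cst 0) id); [exact: cst_continuous|].
exact: cvg_id.
Qed.

(** The increase of [mu / rho] is controlled by the violation alone, since
[[t^2 - sigma^2]_+ = v (v + 2 sigma)] for the violation [v] of [t]. *)
Lemma multiplier_step (R : realType) (sigma mu rho t : R) :
  0 <= sigma -> 0 <= mu -> 0 < rho -> 0 <= t ->
  pospart (mu + rho * (t ^+ 2 - sigma ^+ 2)) / rho <=
  mu / rho + violation sigma t * (violation sigma t + 2 * sigma).
Proof.
move=> s0 m0 r0 t0; rewrite ler_pdivrMr// mulrDl mulfVK ?gt_eqF//.
set v := violation sigma t.
have v0 : 0 <= v := pospart_ge0 _.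
have dv : t ^+ 2 - sigma ^+ 2 <= v * (v + 2 * sigma).
  have : t - sigma <= v := pospart_ge _.
  nra.
have vv : 0 <= v * (v + 2 * sigma) by nra.
rewrite {1}/pospart ge_max; nra.
Qed.

(** A nonzero violation means [d = t^2 - sigma^2 > 0], and expanding the square
turns the bound on the penalty term into [2 mu d + rho d^2 <= 2 Ups].  The
nonnegative term [2 mu d] is dropped, so the result does not involve the
multiplier. *)
Lemma violation_pow4_le (R : realType) (sigma mu rho Ups t : R) :
  0 <= sigma -> 0 <= mu -> 0 < rho -> 0 <= t ->
  (2 * rho)^-1 *
    (pospart (mu + rho * (t ^+ 2 - sigma ^+ 2)) ^+ 2 - mu ^+ 2) <= Ups ->
  violation sigma t != 0 -> violation sigma t ^+ 4 <= 2 * Ups / rho.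
Proof.
move=> s0 m0 r0 t0; rewrite ler_pdivrMl ?mulr_gt0// => H vn0.
have v0 : 0 < violation sigma t by rewrite lt_def vn0 pospart_ge0.
have [ts|ts] := leP t sigma.
  by move: vn0; rewrite /violation pospart_le0 ?eqxx// subr_le0.
have vE : violation sigma t = t - sigma.
  by rewrite /violation pospart_id// subr_ge0 ltW.
have dv : violation sigma t ^+ 2 <= t ^+ 2 - sigma ^+ 2 by rewrite vE; nra.
set v := violation sigma t in v0 dv *.
set d := t ^+ 2 - sigma ^+ 2 in H dv.
have d0 : 0 <= d by apply: le_trans (sqr_ge0 v) dv.
rewrite pospart_id in H; last by rewrite addr_ge0// mulr_ge0// ltW.
have vd : v ^+ 4 <= d ^+ 2.
  by rewrite (exprM v 2 2) ler_sqr ?nnegrE ?sqr_ge0.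
apply: le_trans vd _; rewrite ler_pdivlMr//.
have : rho * (d ^+ 2 * rho) <= rho * (2 * Ups).
  by have := mulr_ge0 m0 (mulr_ge0 (ltW r0) d0); nra.
by rewrite ler_pM2l.
Qed.

(** For [0 < eta < 1], [C] is the sum of the series
[(1 + 2 sigma) (eta + eta^2 + ...)]: as long as the violation is at most [1] and
keeps shrinking by [eta], [C] times its current value bounds the total increase
of [mu / rho] that is still to come. *)
Lemma potential_nonincreasing (R : realType)
    (sigma eta C mu mu' rho t t' : R) :
  0 <= sigma -> 0 <= C -> C * (1 - eta) = (1 + 2 * sigma) * eta ->
  0 <= mu -> 0 < rho -> 0 <= t' ->
  mu' = pospart (mu + rho * (t' ^+ 2 - sigma ^+ 2)) ->
  violation sigma t' <= eta * violation sigma t -> violation sigma t' <= 1 ->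
  mu' / rho + C * violation sigma t' <= mu / rho + C * violation sigma t.
Proof.
move=> s0 C0 CE m0 r0 t0 -> ht v1.
have := multiplier_step s0 m0 r0 t0.
have w0' : 0 <= violation sigma t' := pospart_ge0 _.
set a := _ / rho; set b := mu / rho.
move: ht v1 w0'; set v := violation sigma t; set v' := violation sigma t'.
move=> ht v1 w0' hab.
have : v' * (v' + 2 * sigma) <= v' * (1 + 2 * sigma) by nra.
have : (C + (1 + 2 * sigma)) * v' <= (C + (1 + 2 * sigma)) * (eta * v).
  by rewrite ler_wpM2l//; lra.
have -> : (C + (1 + 2 * sigma)) * (eta * v) = C * v.
  by rewrite mulrA; congr (_ * v); lra.
nra.
Qed.

(** If [mu > delta rho] with [rho] large, then [mu^theta > 1 / delta], so
[mu^(1 + theta) > rho]. *)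
Lemma ratio_small (R : realType) (theta delta : R) :
  0 < theta -> 0 < delta ->
  exists M : R, forall mu rho : R,
    0 <= mu -> M <= rho -> 0 < rho -> mu `^ (1 + theta) <= rho ->
    mu / rho <= delta.
Proof.
move=> th0 d0; exists (delta^-1 * (delta^-1) `^ theta^-1) => mu rho m0 Mr r0 hm.
rewrite ler_pdivrMr// leNgt; apply/negP => dm.
have m0' : 0 < mu by apply: le_lt_trans dm; rewrite mulr_ge0// ltW.
have Mm : (delta^-1) `^ theta^-1 < mu.
  by apply: le_lt_trans dm; rewrite -ler_pdivrMl.
have : delta^-1 < mu `^ theta.
  have := @gt0_ltr_powR R theta th0 ((delta^-1) `^ theta^-1) mu.
  rewrite !nnegrE powR_ge0 => /(_ isT m0 Mm).
  by rewrite -powRrM mulVf ?gt_eqF// powRr1// invr_ge0 ltW.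
move: hm; rewrite powRD; last by rewrite gt_eqF ?implybT ?implyFb//; lra.
rewrite powRr1// => hm dm'.
have : rho < mu * mu `^ theta.
  apply: (@lt_trans _ _ (mu * delta^-1)); last by rewrite ltr_pM2l.
  by rewrite ltr_pdivlMr// mulrC.
by rewrite ltNge hm.
Qed.

(** * Multiplier and penalty sequences *)

(** The scalar part of the algorithm, with [e k] standing for the residual norm
at the [k]-th iterate.  The inequality is what remains of the bound on the
augmented Lagrangian once the nonnegative objective is dropped. *)
Definition penalty_run (R : realType) (sigma gamma theta eta Ups : R)
    (e mu rho : nat -> R) : Prop :=
  [/\ 0 <= mu 0%N, 0 < rho 0%N, forall k, 0 <= e k &
    forall k,
    [/\ mu k.+1 = pospart (mu k + rho k * (e k.+1 ^+ 2 - sigma ^+ 2)),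
        (2 * rho k)^-1 * (mu k.+1 ^+ 2 - mu k ^+ 2) <= Ups
      & rho k.+1 =
          if violation sigma (e k.+1) <= eta * violation sigma (e k) then rho k
          else Num.max (gamma * rho k) (mu k.+1 `^ (1 + theta))]].

Lemma run_mu_ge0 (R : realType) (sigma gamma theta eta Ups : R)
    (e mu rho : nat -> R) :
  penalty_run sigma gamma theta eta Ups e mu rho -> forall k, 0 <= mu k.
Proof.
by move=> [m0 _ _ st] [//|k]; have [-> _ _] := st k; apply: pospart_ge0.
Qed.

Lemma run_rho_step (R : realType) (sigma gamma theta eta Ups : R)
    (e mu rho : nat -> R) :
  1 < gamma -> penalty_run sigma gamma theta eta Ups e mu rho ->
  forall k, 0 < rho k <= rho k.+1.
Proof.
move=> g1 [_ r0 _ st].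
have step k : 0 < rho k -> rho k <= rho k.+1.
  move=> rk; have [_ _ ->] := st k; case: ifP => // _.
  by rewrite le_max ler_peMl// ltW.
have pos k : 0 < rho k.
  by elim: k => // k IH; apply: lt_le_trans IH (step _ IH).
by move=> k; rewrite pos step.
Qed.

(** A bounded penalty converges to its supremum [l]; once it exceeds
[l / gamma], an update would make it larger than [l]. *)
Lemma run_penalty_dichotomy (R : realType) (sigma gamma theta eta Ups : R)
    (e mu rho : nat -> R) :
  1 < gamma -> penalty_run sigma gamma theta eta Ups e mu rho ->
  rho @ \oo --> +oo \/
  \forall k \near \oo,
    violation sigma (e k.+1) <= eta * violation sigma (e k).
Proof.
move=> g1 run; have rs := run_rho_step g1 run.
have nd : nondecreasing_seq rho.
  by apply/nondecreasing_seqP => k; have /andP[] := rs k.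
have r0 k : 0 < rho k by have /andP[] := rs k.
have [cv|dv] := pselect (cvgn rho); last by left; apply: nondecreasing_dvgn_lt.
right; set l := limn rho in cv.
have rl k : rho k <= l := nondecreasing_cvgn_le nd cv k.
have l0 : 0 < l by apply: lt_le_trans (rl 0%N).
have lg : l / gamma < l by rewrite ltr_pdivrMr ?ltr_pMr// (lt_trans ltr01).
have : \forall k \near \oo, l / gamma < rho k by exact: (cvgr_gt _ cv).
apply: filterS => k hk; apply: contraT => nv.
have [_ _ _ /(_ k)[_ _]] := run; rewrite (negbTE nv) => rE.
have : gamma * rho k <= l by rewrite (le_trans _ (rl k.+1))// rE le_max lexx.
by rewrite leNgt; move: hk; rewrite ltr_pdivrMr ?(lt_trans ltr01)// mulrC => ->.
Qed.

Lemma geometric_decay_cvg0 (R : realType) (eta : R) (v : nat -> R) :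
  0 < eta < 1 -> (forall k, 0 <= v k) ->
  (\forall k \near \oo, v k.+1 <= eta * v k) -> v @ \oo --> 0.
Proof.
move=> /andP[e0 e1] v0 [K _ hK].
rewrite -(cvg_shiftn K).
apply: (@squeeze_cvgr _ _ _ _ (cst 0) (fun k => eta ^+ k * v K)); last 2 first.
- exact: cvg_cst.
- rewrite -[X in _ --> X](mul0r (v K)); apply: cvgMr_tmp.
  by apply: cvg_expr; rewrite gtr0_norm.
apply: nearW => k; rewrite v0 /=; elim: k => [|k IH].
  by rewrite add0n expr0 mul1r.
rewrite addSn (le_trans (hK _ _)) /= ?leq_addl// exprS -mulrA.
by rewrite ler_pM2l.
Qed.

Lemma run_violation_cvg0 (R : realType) (sigma gamma theta eta Ups : R)
    (e mu rho : nat -> R) :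
  0 <= sigma -> 0 < eta < 1 -> 1 < gamma ->
  penalty_run sigma gamma theta eta Ups e mu rho ->
  violation sigma (e k) @[k --> \oo] --> 0.
Proof.
move=> s0 eta01 g1 run.
have [roo|vs] := run_penalty_dichotomy g1 run; last first.
  by apply: geometric_decay_cvg0 eta01 _ vs => k; apply: pospart_ge0.
rewrite -cvg_shiftS; apply/cvgr0Pnorm_lt => d d0.
have : \forall k \near \oo, 2 * Ups / d ^+ 4 < rho k by exact: (cvgry_gt roo).
apply: filterS => k hk /=; rewrite ger0_norm ?pospart_ge0//.
rewrite ltNge; apply/negP => dv.
have [_ _ e0 /(_ k)[muE lag _]] := run; rewrite muE in lag.
have /andP[rk _] := run_rho_step g1 run k.
have vp : 0 < violation sigma (e k.+1) by apply: lt_le_trans dv.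
have v4 := violation_pow4_le s0 (run_mu_ge0 run k) rk (e0 _) lag (lt0r_neq0 vp).
have : d ^+ 4 <= 2 * Ups / rho k.
  by apply: le_trans v4; rewrite lerXn2r// nnegrE ltW.
rewrite ler_pdivlMr// leNgt.
by move: hk; rewrite ltr_pdivrMr ?exprn_gt0// [rho k * _]mulrC => ->.
Qed.

(** The potential [mu / rho + C v] is nonincreasing on the steps that keep the
penalty.  If the penalty is eventually constant, the potential therefore
converges.  If the penalty is unbounded, updates occur arbitrarily late; a late
one brings the potential below a given threshold, under which it stays. *)
Lemma run_ratio_cvg (R : realType) (sigma gamma theta eta Ups : R)
    (e mu rho : nat -> R) :
  0 <= sigma -> 0 < eta < 1 -> 1 < gamma -> 0 < theta ->
  penalty_run sigma gamma theta eta Ups e mu rho ->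
  exists2 q : R, mu k / rho k @[k --> \oo] --> q &
    q = 0 \/ \forall k \near \oo, rho k.+1 = rho k.
Proof.
move=> s0 eta01 g1 th0 run.
have v0 := run_violation_cvg0 s0 eta01 g1 run.
have m0 := run_mu_ge0 run; have rs := run_rho_step g1 run.
have r0 k : 0 < rho k by have /andP[] := rs k.
have [_ _ e0 st] := run.
pose C := (1 + 2 * sigma) * eta / (1 - eta).
have CE : C * (1 - eta) = (1 + 2 * sigma) * eta.
  by rewrite /C mulfVK//; apply/eqP => ?; move: eta01 => /andP[]; lra.
have C0 : 0 <= C.
  move/andP: eta01 => [? ?]; rewrite /C divr_ge0//; first by nra.
  by rewrite subr_ge0 ltW.
pose V k := mu k / rho k + C * violation sigma (e k).
have Vge0 k : 0 <= V k.
  apply: addr_ge0; first by rewrite divr_ge0 ?m0// ltW.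
  by rewrite mulr_ge0 ?pospart_ge0.
have Cv0 : C * violation sigma (e k) @[k --> \oo] --> 0.
  by rewrite -[X in _ --> X](mulr0 C); apply: cvgMl_tmp.
have VE k : mu k / rho k = V k - C * violation sigma (e k) by rewrite addrK.
have v1 : \forall k \near \oo, violation sigma (e k.+1) <= 1.
  have [K _ hK] := cvgr_le _ v0 _ ltr01.
  by exists K => // k /= Kk; apply: hK; apply: leqW.
have dec : \forall k \near \oo,
    violation sigma (e k.+1) <= eta * violation sigma (e k) -> V k.+1 <= V k.
  apply: filterS v1 => k vk tst; rewrite /V; have [muE _ ->] := st k.
  by rewrite tst; apply: potential_nonincreasing muE tst vk.
have [roo|vs] := run_penalty_dichotomy g1 run.
  exists 0; last by left.
  have V0 : V @ \oo --> 0.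
    apply/cvgr0Pnorm_le => d d0.
    have d2 : 0 < d / 2 by rewrite divr_gt0.
    have [M HM] := ratio_small th0 d2.
    have rM : \forall k \near \oo, M <= rho k by exact: (cvgry_ge roo).
    have vd : \forall k \near \oo, C * violation sigma (e k) <= d / 2.
      exact: (cvgr_le _ Cv0).
    have [K _ hK] := filterI dec (filterI rM vd).
    have upd k : (K <= k)%N ->
        ~~ (violation sigma (e k.+1) <= eta * violation sigma (e k)) ->
        V k.+1 <= d.
      move=> Kk nv; have [_ _ rE] := st k; rewrite (negbTE nv) in rE.
      have [_ [rk vk]] := hK k.+1 (leqW Kk).
      rewrite [d]splitr lerD// HM// rE le_max lexx orbT//.
    (* Without an update after [K] the penalty would be bounded. *)
    have [k0 Kk0 Vk0] : exists2 k0, (K <= k0)%N & V k0 <= d.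
      apply: contrapT => nex.
      have always k : (K <= k)%N -> rho k = rho K.
        elim: k => [|k IH]; first by rewrite leqn0 => /eqP <-.
        rewrite leq_eqVlt => /predU1P[<-//|Kk].
        have [_ _ ->] := st k; case: ifPn => [_|nv]; first exact: IH.
        by case: nex; exists k.+1; [exact: leqW|exact: upd].
      have /filter_ex [k [hk Kk]] :
          \forall k \near \oo, rho K < rho k /\ (K <= k)%N.
        by apply: filterI; [exact: (cvgry_gt roo)|exact: nbhs_infty_ge].
      by move: hk; rewrite always// ltxx.
    exists k0 => // k /=; rewrite ger0_norm//; elim: k => [|k IH].
      by rewrite leqn0 => /eqP kE; rewrite kE in Vk0.
    rewrite leq_eqVlt => /predU1P[<-//|k0k].
    have Kk : (K <= k)%N by apply: leq_trans Kk0 k0k.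
    have [tst|] :=
      boolP (violation sigma (e k.+1) <= eta * violation sigma (e k)).
      by have [/(_ tst) h _] := hK k Kk; apply: le_trans h (IH _).
    exact: upd.
  by rewrite (funext VE) -[X in _ --> X](subr0 0); apply: cvgB.
have rst : \forall k \near \oo, rho k.+1 = rho k.
  by apply: filterS vs => k vk; have [_ _ ->] := st k; rewrite vk.
have cV : cvgn V.
  have [K _ hK] := filterI dec vs.
  have : cvgn (fun k => V (k + K)%N).
    apply: nonincreasing_is_cvgn; last by exists 0 => _ [k _ <-].
    apply/nonincreasing_seqP => k; have [h /h] := hK (k + K)%N (leq_addl _ _).
    by rewrite addSn.
  by move/cvg_ex => [l]; rewrite cvg_shiftn => hl; apply/cvg_ex; exists l.
exists (limn V); last by right.
by rewrite (funext VE) -[X in _ --> X]subr0; apply: cvgB.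
Qed.

(** When [mu / rho] tends to [0], the argument of the positive part is
eventually negative.  When the penalty is eventually constant, passing to the
limit in the update gives [q = [q + d]_+] for the limit [q] of [mu / rho] and
[d = l^2 - sigma^2 < 0], so that again [q = 0]. *)
Lemma run_inactive_multiplier (R : realType) (sigma gamma theta eta Ups : R)
    (e mu rho : nat -> R) (f : nat -> nat) (l : R) :
  0 <= sigma -> 0 < eta < 1 -> 1 < gamma -> 0 < theta ->
  penalty_run sigma gamma theta eta Ups e mu rho ->
  f @ \oo --> \oo -> e (f k).+1 @[k --> \oo] --> l -> 0 <= l < sigma ->
  \forall k \near \oo, mu (f k).+1 = 0.
Proof.
move=> s0 eta01 g1 th0 run foo el /andP[l0 ls].
have [q qc qdich] := run_ratio_cvg s0 eta01 g1 th0 run.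
have rs := run_rho_step g1 run.
have r0 k : 0 < rho k by have /andP[] := rs k.
have [_ _ e0 st] := run.
have slack : l ^+ 2 - sigma ^+ 2 < 0 by nra.
have sum_cvg : mu (f k) / rho (f k) + (e (f k).+1 ^+ 2 - sigma ^+ 2)
    @[k --> \oo] --> q + (l ^+ 2 - sigma ^+ 2).
  apply: cvgD; first exact: (cvg_comp _ _ foo qc).
  apply: cvgB; last exact: cvg_cst.
  by rewrite !expr2; under eq_fun do rewrite expr2; apply: cvgM.
have muE k : mu k.+1 =
    pospart (rho k * (mu k / rho k + (e k.+1 ^+ 2 - sigma ^+ 2))).
  by have [-> _ _] := st k; congr pospart; field; rewrite gt_eqF.
have q0 : q = 0.
  case: qdich => // rst.
  have qS : pospart (mu (f k) / rho (f k) + (e (f k).+1 ^+ 2 - sigma ^+ 2))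
      @[k --> \oo] --> q.
    have : mu (f k).+1 / rho (f k).+1 @[k --> \oo] --> q.
      have : mu k.+1 / rho k.+1 @[k --> \oo] --> q.
        by rewrite (cvg_shiftS (fun k => mu k / rho k)).
      exact: (cvg_comp _ _ foo).
    apply: cvg_trans; apply: near_eq_cvg; near=> k; symmetry.
    have -> : rho (f k).+1 = rho (f k) by near: k; exact: (foo _ rst).
    rewrite muE /pospart -[X in Num.max X (rho _ * _)](mulr0 (rho (f k))).
    by rewrite -maxr_pMr 1?ltW// [RHS]mulrC mulKf// gt_eqF.
  have limS : pospart (mu (f k) / rho (f k) + (e (f k).+1 ^+ 2 - sigma ^+ 2))
      @[k --> \oo] --> pospart (q + (l ^+ 2 - sigma ^+ 2)).
    by apply: continuous_cvg sum_cvg; apply: pospart_continuous.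
  have : q = pospart (q + (l ^+ 2 - sigma ^+ 2)).
    exact: (cvg_unique _ qS limS).
  by rewrite /pospart; case: leP => hq E; lra.
rewrite q0 add0r in sum_cvg.
have : \forall k \near \oo,
    mu (f k) / rho (f k) + (e (f k).+1 ^+ 2 - sigma ^+ 2) < 0.
  exact: (cvgr_lt _ sum_cvg).
apply: filterS => k hk; rewrite muE pospart_le0//.
by rewrite pmulr_rle0// ltW.
Unshelve. all: by end_near. Qed.

(** * Continuity of the objective *)

(** Counting characterizes order statistics without reference to the sorting
permutation; this is what makes them comparable for two different vectors. *)
Lemma le_nth_sorted (R : realType) (s : seq R) (t : R) (i : nat) :
  sorted >=%R s -> (i < size s)%N ->
  (t <= nth 0 s i) = (i < count (>= t) s)%N.
Proof.
elim: s i => [//|a s IH] i /= path_s i_s.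
have all_le y : y \in s -> y <= a.
  have /allP := order_path_min ge_trans path_s; exact.
have no_count : a < t -> count (>= t) s = 0%N.
  move=> at_; apply/eqP; rewrite eqn0Ngt -has_count; apply/hasPn => y ys /=.
  by rewrite -ltNge; apply: le_lt_trans at_; exact: all_le.
case: i i_s => [|i] /=; rewrite ?ltnS => i_s.
  by have [//|at_] := leP t a; rewrite no_count.
rewrite IH ?(path_sorted path_s)//.
have [_|at_] := leP t a; first by rewrite add1n ltnS.
by rewrite no_count// !ltn0.
Qed.

(** Every entry counted above a level for [u] is counted above the level
lowered by [d] for [w]. *)
Lemma abs_ord_le_add (R : realType) (n : nat) (u w : 'cV[R]_n) (d : R)
    (i : nat) :
  (0 < i <= n)%N -> (forall j, `|u j 0| <= `|w j 0| + d) ->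
  abs_ord u i <= abs_ord w i + d.
Proof.
move=> /andP[i0 i_n] uw; rewrite -lerBlDr /abs_ord.
pose vals (z : 'cV[R]_n) := [seq `|z j 0| | j <- enum 'I_n].
have rank t z : (t <= nth 0 (sort >=%R (vals z)) i.-1) =
    (i.-1 < count (>= t) (vals z))%N.
  rewrite le_nth_sorted ?count_sort//.
    by apply: sort_sorted => a b; exact: ge_total.
  by rewrite size_sort size_map size_enum_ord prednK.
rewrite -!/(vals _) rank; set t := nth _ _ _.
have := lexx t; rewrite {2}/t rank => /leq_trans; apply.
rewrite !count_map; apply: sub_count => j /= tj.
by rewrite lerBlDr (le_trans tj).
Qed.

Lemma coord_le_norm (R : realType) (m n : nat) (z : 'M[R]_(m, n)) i j :
  `|z i j| <= `|z|.
Proof.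
rewrite [leRHS]mx_normrE.
exact: (le_bigmax _ (fun ij => `|z ij.1 ij.2|) (i, j)).
Qed.

Lemma abs_ord_lipschitz (R : realType) (n : nat) (u w : 'cV[R]_n) (i : nat) :
  (0 < i <= n)%N -> `|abs_ord u i - abs_ord w i| <= `|u - w|.
Proof.
move=> hi.
have bound (y z : 'cV[R]_n) j : `|y j 0| <= `|z j 0| + `|y - z|.
  rewrite -lerBlDl; apply: le_trans (lerB_dist _ _) _.
  by have := coord_le_norm (y - z) j 0; rewrite !mxE.
rewrite ler_distlC; apply/andP; split.
  by rewrite lerBlDr; apply: abs_ord_le_add.
by rewrite distrC; apply: abs_ord_le_add.
Qed.

Lemma abs_ord_ge0 (R : realType) (n : nat) (u : 'cV[R]_n) (i : nat) :
  0 <= abs_ord u i.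
Proof.
rewrite /abs_ord; set s := sort _ _.
have [/(nth_default 0)->//|i_s] := leqP (size s) i.-1.
have : nth 0 s i.-1 \in s by rewrite mem_nth.
by rewrite mem_sort => /mapP[j _ ->].
Qed.

Lemma Phi_ge0 (R : realType) (n : nat) (phi : R -> R) (r : nat) (u : 'cV[R]_n) :
  {in `[0, +oo[ &, {homo phi : s t / s <= t}} -> phi 0 = 0 ->
  0 <= Phi phi r u.
Proof.
move=> incr phi0; apply: sumr_ge0 => i _; rewrite -phi0.
by apply: incr; rewrite ?in_itv/= ?lexx ?abs_ord_ge0.
Qed.

Lemma abs_ord_continuous (R : realType) (n : nat) (i : nat) :
  (0 < i <= n)%N -> continuous (fun u : 'cV[R]_n => abs_ord u i).
Proof.
move=> hi u; apply/(@cvgrPdist_lt _ R _ _ (nbhs_filter u)) => d d0.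
apply/nbhs_ballP; exists d => //= w; rewrite mx_norm_ball /=.
exact/le_lt_trans/abs_ord_lipschitz.
Qed.

Lemma Phi_continuous (R : realType) (n : nat) (phi : R -> R) (r : nat) :
  {within `[0, +oo[, continuous phi} ->
  continuous (Phi phi r : 'cV[R]_n -> R).
Proof.
move=> /subspace_continuousP phi_cont u.
have -> : Phi phi r = (fun w : 'cV[R]_n =>
    \sum_(r.+1 <= i < n.+1 | (r < i < n.+1)%N && true) phi (abs_ord w i)).
  by apply/funext => w; rewrite /Phi big_nat_cond.
apply: cvg_big => [| |i /andP[/andP[ri i_n] _]].
- by move=> p; exact: add_continuous.
- exact: nbhs_filter.
have hi : (0 < i <= n)%N by rewrite (leq_ltn_trans _ ri).
have nneg (w : 'cV[R]_n) : `[0, +oo[%classic (abs_ord w i).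
  by rewrite /= in_itv/= abs_ord_ge0.
move=> V /(phi_cont _ (nneg u)) /(abs_ord_continuous hi).
by apply: (@filterS _ _ (nbhs_filter u)) => w; apply; exact: nneg.
Qed.

(** * Limits of subgradients *)

Lemma cvg_entries (R : realType) (T : Type) (F : set_system T) (m n : nat)
    (f : T -> 'M[R]_(m, n)) (l : 'M[R]_(m, n)) :
  Filter F -> (forall i j, f t i j @[t --> F] --> l i j) -> f @ F --> l.
Proof.
move=> FF fl V [P Pl PV].
apply: (@filterS _ F _ [set t | forall i j, P i j (f t i j)]).
  by move=> t Pt; apply: PV.
apply: filter_forall => i; apply: filter_forall => j.
exact: fl (Pl i j).
Qed.

Lemma entry_cvg (R : realType) (T : Type) (F : set_system T) (m n : nat)
    (f : T -> 'M[R]_(m, n)) (l : 'M[R]_(m, n)) i j :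
  f @ F --> l -> f t i j @[t --> F] --> l i j.
Proof.
by move=> fl; exact: (cvg_comp _ _ fl (@coord_continuous _ _ _ i j l)).
Qed.

Lemma cvg_mulmx (R : realType) (T : Type) (F : set_system T) (m n p : nat)
    (A : 'M[R]_(m, n)) (f : T -> 'M[R]_(n, p)) (l : 'M[R]_(n, p)) :
  Filter F -> f @ F --> l -> A *m f t @[t --> F] --> A *m l.
Proof.
move=> FF fl; apply: cvg_entries => i j; rewrite mxE.
under eq_fun do rewrite mxE.
apply: cvg_big => [|k _]; first by move=> q; exact: add_continuous.
by apply: cvgM; [exact: cvg_cst|exact: entry_cvg].
Qed.

Lemma dotp_ge0 (R : realType) (n : nat) (u : 'cV[R]_n) : 0 <= dotp u u.
Proof. by apply: sumr_ge0 => i _; rewrite -expr2 sqr_ge0. Qed.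

Lemma enorm_ge0 (R : realType) (n : nat) (u : 'cV[R]_n) : 0 <= enorm u.
Proof. exact: sqrtr_ge0. Qed.

Lemma cvg_enorm (R : realType) (T : Type) (F : set_system T) (n : nat)
    (f : T -> 'cV[R]_n) (l : 'cV[R]_n) :
  Filter F -> f @ F --> l -> enorm (f t) @[t --> F] --> enorm l.
Proof.
move=> FF fl.
suff sq : dotp (f t) (f t) @[t --> F] --> dotp l l.
  exact: (cvg_comp _ _ sq (@sqrt_continuous R _)).
apply: cvg_big => [|k _]; first by move=> q; exact: add_continuous.
by apply: cvgM; exact: entry_cvg.
Qed.

Lemma norm_le_enorm (R : realType) (n : nat) (u : 'cV[R]_n) : `|u| <= enorm u.
Proof.
rewrite [leLHS]mx_normrE; apply: bigmax_le; first exact: enorm_ge0.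
move=> [i j] _ /=; rewrite ord1 -sqrtr_sqr; apply: ler_wsqrtr.
rewrite /dotp (bigD1 i)//= expr2 lerDl.
by apply: sumr_ge0 => k _; rewrite -expr2 sqr_ge0.
Qed.

Lemma cvg_infty_ge (h : nat -> nat) :
  (forall k, (k <= h k)%N) -> h @ \oo --> \oo.
Proof.
move=> hk V [N _ NV]; exists N => // k /= Nk; apply: NV => /=.
exact: leq_trans (hk k).
Qed.

Lemma increasing_seq_cvg_infty (h : nat -> nat) :
  increasing_seq h -> h @ \oo --> \oo.
Proof.
move=> /increasing_seqP hS; apply: cvg_infty_ge; elim=> [//|k IH].
exact: leq_ltn_trans IH (hS k).
Qed.

(** The shift by one is what is needed for sequences whose information on
[x k.+1] is indexed by [k]. *)
Lemma cluster_subsequence (R : realType) (m n : nat) (x : nat -> 'M[R]_(m, n))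
    (xs : 'M[R]_(m, n)) :
  cluster (x k @[k --> \oo]) xs ->
  exists2 f : nat -> nat, f @ \oo --> \oo & x (f k).+1 @[k --> \oo] --> xs.
Proof.
move=> clx.
have /choice[f hf] k : exists j, (k <= j)%N /\ `|xs - x j.+1| < k.+1%:R^-1.
  have e0 : 0 < k.+1%:R^-1 :> R by rewrite invr_gt0.
  have Fk : (x k @[k --> \oo]) [set x j.+1 | j in [set j | (k <= j)%N]].
    by exists k.+1 => // -[//|j] /= kj; exists j.
  have [_ [[j kj <-]]] := clx _ _ Fk (nbhsx_ballx xs _ e0).
  by rewrite mx_norm_ball /= => h; exists j.
exists f; first by apply: cvg_infty_ge => k; have [] := hf k.
apply/cvgrPdist_lt => d d0.
have [N _ hN] := near_infty_natSinv_lt (PosNum d0).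
exists N => // k Nk /=; have [_ h] := hf k.
exact: lt_trans h (hN k Nk).
Qed.

(** Diagonal argument: each limiting subgradient [v k] is replaced by a regular
one at distance less than [1 / (k + 1)]. *)
Lemma subdiff_diagonal (R : realType) (n : nat) (f : 'cV[R]_n -> R)
    (x : 'cV[R]_n) (z v : nat -> 'cV[R]_n) :
  z @ \oo --> x -> f (z k) @[k --> \oo] --> f x ->
  (forall k, limiting_subdiff f (z k) (v k)) ->
  exists y w : nat -> 'cV[R]_n,
    [/\ y @ \oo --> x, f (y k) @[k --> \oo] --> f x,
        forall k, regular_subdiff f (y k) (w k)
      & w k - v k @[k --> \oo] --> (0 : 'cV[R]_n)].
Proof.
move=> zx fzx vz.
have /choice[yw hyw] k : exists p : 'cV[R]_n * 'cV[R]_n,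
    [/\ regular_subdiff f p.1 p.2, `|z k - p.1| < k.+1%:R^-1,
        `|f (z k) - f p.1| < k.+1%:R^-1 & `|v k - p.2| < k.+1%:R^-1].
  have e0 : 0 < k.+1%:R^-1 :> R by rewrite invr_gt0.
  have [y [w [yz fyz wr wv]]] := vz k.
  have /filter_ex[j [h1 h2 h3]] : \forall j \near \oo,
      [/\ `|z k - y j| < k.+1%:R^-1, `|f (z k) - f (y j)| < k.+1%:R^-1
        & `|v k - w j| < k.+1%:R^-1].
    near=> j; split; near: j.
    - exact: (cvgrPdist_lt _ _).1 yz _ e0.
    - exact: (cvgrPdist_lt _ _).1 fyz _ e0.
    - exact: (cvgrPdist_lt _ _).1 wv _ e0.
  by exists (y j, w j); split=> //; exact: wr.
have small (V : normedModType R) (a : nat -> V) :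
    (forall k, `|a k| < k.+1%:R^-1) -> a @ \oo --> 0.
  move=> ha; apply/cvgr0Pnorm_lt => d d0.
  have [N _ hN] := near_infty_natSinv_lt (PosNum d0).
  by exists N => // k Nk /=; exact: lt_trans (ha k) (hN k Nk).
have perturb (V : normedModType R) (a c : nat -> V) (l : V) : a @ \oo --> l ->
    (forall k, `|a k - c k| < k.+1%:R^-1) -> c @ \oo --> l.
  move=> al ac; have -> : c = (fun k => a k - (a k - c k)).
    by apply/funext => k; rewrite subKr.
  by rewrite -[l]subr0; apply: cvgB => //; apply: small.
exists (fun k => (yw k).1), (fun k => (yw k).2); split.
- by apply: perturb zx _ => k; have [] := hyw k.
- by apply: (perturb R^o) fzx _ => k; have [] := hyw k.
- by move=> k; have [] := hyw k.
- by apply: small => k; rewrite distrC; have [] := hyw k.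
Unshelve. all: by end_near. Qed.

Lemma limiting_subdiff_closed (R : realType) (n : nat) (f : 'cV[R]_n -> R)
    (x v0 : 'cV[R]_n) (z v : nat -> 'cV[R]_n) :
  z @ \oo --> x -> f (z k) @[k --> \oo] --> f x ->
  (forall k, limiting_subdiff f (z k) (v k)) -> v @ \oo --> v0 ->
  limiting_subdiff f x v0.
Proof.
move=> zx fzx vz vv0; have [y [w [yx fyx wr wv]]] := subdiff_diagonal zx fzx vz.
exists y, w; split => //.
have -> : w = (fun k => (w k - v k) + v k) by apply/funext => k; rewrite subrK.
by rewrite -[v0]add0r; apply: cvgD.
Qed.

Lemma horizon_subdiff_closed (R : realType) (n : nat) (f : 'cV[R]_n -> R)
    (x v0 : 'cV[R]_n) (z v : nat -> 'cV[R]_n) (lam : nat -> R) :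
  z @ \oo --> x -> f (z k) @[k --> \oo] --> f x ->
  (forall k, limiting_subdiff f (z k) (v k)) ->
  (forall k, 0 < lam k) -> lam @ \oo --> 0 ->
  lam k *: v k @[k --> \oo] --> v0 -> horizon_subdiff f x v0.
Proof.
move=> zx fzx vz lam0 lamc vv0.
have [y [w [yx fyx wr wv]]] := subdiff_diagonal zx fzx vz.
exists y, w, lam; split => //.
have -> : (fun k => lam k *: w k) =
    (fun k => lam k *: (w k - v k) + lam k *: v k).
  by apply/funext => k; rewrite -scalerDr subrK.
rewrite -[v0]add0r; apply: cvgD => //.
by rewrite -[X in _ --> X](scale0r (0 : 'cV[R]_n)); apply: cvgZ.
Qed.

(** Bolzano-Weierstrass for the multipliers [m]: on a subsequence along which
they converge, the subgradients [v k] converge too; without one, [m k] tends to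
infinity and [v k / m k] tends to [- g0], a horizon subgradient. *)
Lemma multiplier_dichotomy (R : realType) (n : nat) (f : 'cV[R]_n -> R)
    (x g0 : 'cV[R]_n) (z g v : nat -> 'cV[R]_n) (m : nat -> R) :
  z @ \oo --> x -> f (z k) @[k --> \oo] --> f x -> g @ \oo --> g0 ->
  (forall k, 0 <= m k) -> (forall k, limiting_subdiff f (z k) (v k)) ->
  m k *: g k + v k @[k --> \oo] --> (0 : 'cV[R]_n) ->
  (exists2 ms : R, 0 <= ms & limiting_subdiff f x (- (ms *: g0))) \/
  horizon_subdiff f x (- g0).
Proof.
move=> zx fzx gg0 m0 vz res.
have [[M often]|rare] :=
  pselect (exists M, forall i, exists j, (i <= j)%N /\ m j <= M).
  left; have [s hs] := choice often.
  have soo : s @ \oo --> \oo by apply: cvg_infty_ge => k; have [] := hs k.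
  have [h /increasing_seq_cvg_infty hoo] : exists2 h : nat -> nat,
      increasing_seq h & cvgn ((m \o s) \o h).
    apply: bolzano_weierstrass; exists M; split; first exact: num_real.
    move=> B MB k _ /=; rewrite ger0_norm// ltW// (le_lt_trans _ MB)//.
    by have [] := hs k.
  move=> /cvg_ex[/= ms mms].
  have shoo : (s \o h) @ \oo --> \oo := cvg_comp _ _ hoo soo.
  exists ms.
    by apply: (cvgr_to_ge mms); apply: nearW => k; exact: m0.
  apply: (@limiting_subdiff_closed _ _ f x _
    (z \o (s \o h)) (v \o (s \o h))) => //.
  - exact: cvg_comp shoo zx.
  - exact: (cvg_comp _ _ shoo fzx).
  - by move=> k; exact: vz.
  - have -> : v \o (s \o h) =
        (fun k => (m (s (h k)) *: g (s (h k)) + v (s (h k)))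
          - m (s (h k)) *: g (s (h k))).
      by apply/funext => k /=; rewrite addrC addKr.
    rewrite -[- (ms *: g0)]sub0r; apply: cvgB.
      exact: (cvg_comp _ _ shoo res).
    by apply: cvgZ => //; exact: (cvg_comp _ _ shoo gg0).
right.
have moo : m @ \oo --> +oo.
  apply/cvgryPgt => M; apply: contrapT => nM; apply: rare; exists M => i.
  apply: contrapT => ni; apply: nM; exists i => // j /= ij.
  by rewrite ltNge; apply/negP => mM; apply: ni; exists j.
(* [m k] may vanish for small [k], while the scaling factors of a horizon
   subgradient must all be positive. *)
pose lam k := (Num.max 1 (m k))^-1.
have lam0 k : 0 < lam k by rewrite invr_gt0 lt_max ltr01.
have lamc : lam @ \oo --> 0.
  have pos : \forall k \near \oo, 0 < Num.max 1 (m k).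
    by apply: nearW => k; rewrite lt_max ltr01.
  apply/(gtr0_cvgV0 pos); apply/cvgryPgt => M.
  have : \forall k \near \oo, M < m k by exact: (cvgry_gt moo).
  by apply: filterS => k Mk; rewrite lt_max Mk orbT.
have lamm : lam k * m k @[k --> \oo] --> (1 : R).
  apply: cvg_near_cst.
  have : \forall k \near \oo, 1 < m k by exact: (cvgry_gt moo).
  apply: filterS => k mk; rewrite /lam max_r ?mulVf ?gt_eqF//; last exact: ltW.
  exact: lt_trans mk.
apply: (horizon_subdiff_closed zx fzx vz lam0 lamc).
have -> : (fun k => lam k *: v k) =
    (fun k => lam k *: (m k *: g k + v k) - (lam k * m k) *: g k).
  by apply/funext => k; rewrite scalerDr scalerA addrC addKr.
rewrite -[- g0]sub0r; apply: cvgB.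
  by rewrite -[X in _ --> X](scale0r (0 : 'cV[R]_n)); apply: cvgZ.
by rewrite -[g0]scale1r; apply: cvgZ.
Qed.

(** * Gradient of the penalty term *)

Lemma pospart_sqr_taylor (R : realType) (s d : R) :
  `|pospart (s + d) ^+ 2 - pospart s ^+ 2 - 2 * pospart s * d| <= d ^+ 2.
Proof.
rewrite /pospart ler_norml.
by case: (leP 0 (s + d)); case: (leP 0 s) => hs hd; apply/andP; split; nra.
Qed.

Lemma enorm_sqr (R : realType) (n : nat) (u : 'cV[R]_n) :
  enorm u ^+ 2 = dotp u u.
Proof. by rewrite /enorm sqr_sqrtr// dotp_ge0. Qed.

Lemma dotp_line (R : realType) (n : nat) (p q : 'cV[R]_n) (h : R) :
  dotp (h *: p + q) (h *: p + q) = dotp q q + h * (h * dotp p p + 2 * dotp p q).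
Proof.
rewrite /dotp mulrDr !mulr_sumr -!big_split /=; apply: eq_bigr => i _.
by rewrite !mxE; ring.
Qed.

(** Along a line the squared residual is a quadratic polynomial, and
[[s]_+^2] has a first-order expansion with quadratic error that is uniform in
[s], so no case distinction at the kink is needed. *)
Lemma gradient_wtilde (R : realType) (m n : nat) (A : 'M[R]_(m, n))
    (b : 'cV[R]_m) (sigma mu rho : R) (x : 'cV[R]_n) :
  0 < rho ->
  gradient (wtilde A b sigma mu rho) x =
  (2 * pospart (mu + rho * (enorm (A *m x - b) ^+ 2 - sigma ^+ 2))) *:
    (A^T *m (A *m x - b)).
Proof.
move=> r0; apply/colP => i; rewrite !mxE.
set q := A *m x - b; set s0 := mu + _.
pose a : 'cV[R]_m := A *m delta_mx i 0.
have aq : \sum_j A^T i j * q j 0 = dotp a q.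
  by apply: eq_bigr => j _; rewrite /a -colE !mxE.
rewrite aq; apply: cvg_lim => //.
pose slope (h : R) := h * dotp a a + 2 * dotp a q.
pose incr h := rho * (h * slope h).
pose rem h := pospart (s0 + incr h) ^+ 2 - pospart s0 ^+ 2
  - 2 * pospart s0 * incr h.
have quotE h : h != 0 ->
    h^-1 *: ((wtilde A b sigma mu rho \o shift x) (h *: delta_mx i 0)
      - wtilde A b sigma mu rho x) =
    pospart s0 * slope h + (2 * rho)^-1 * (h^-1 * rem h).
  move=> h0; rewrite /wtilde /= mulmxDr -addrA -scalemxAr -/a -/q.
  rewrite !enorm_sqr dotp_line.
  have -> : mu + rho * (dotp q q + h * (h * dotp a a + 2 * dotp a q)
      - sigma ^+ 2) = s0 + incr h.
    by rewrite /s0 /incr /slope enorm_sqr; ring.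
  rewrite -enorm_sqr -/s0 -mulrBr /GRing.scale/= /rem /incr.
  by field; rewrite h0 gt_eqF.
have slope_cvg : slope h @[h --> 0^'] --> 2 * dotp a q.
  rewrite -[X in _ --> X]add0r; apply: cvgD; last exact: cvg_cst.
  rewrite -[X in _ --> X](mul0r (dotp a a)); apply: cvgM; last exact: cvg_cst.
  exact: nbhs_dnbhs.
have rem_cvg : h^-1 * rem h @[h --> 0^'] --> 0.
  apply/norm_cvg0P.
  apply: (@squeeze_cvgr _ _ _ _ (cst 0)
    (fun h => rho ^+ 2 * (`|h| * (slope h * slope h)))).
  - near=> h; rewrite normr_ge0 normrM normfV /=.
    have h0 : h != 0 by near: h; exact: nbhs_dnbhs_neq.
    rewrite ler_pdivrMl ?normr_gt0//.
    apply: le_trans (pospart_sqr_taylor _ _) _.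
    rewrite le_eqVlt; apply/orP; left; apply/eqP; rewrite /incr.
    by rewrite -!expr2 !exprMn -[in LHS](real_normK (num_real h)); ring.
  - exact: cvg_cst.
  - rewrite -[X in _ --> X](mulr0 (rho ^+ 2)); apply: cvgMl_tmp.
    rewrite -[X in _ --> X](mul0r (2 * dotp a q * (2 * dotp a q))).
    apply: cvgM; last exact: cvgM.
    by apply/norm_cvg0P; exact: nbhs_dnbhs.
have lim_cvg : pospart s0 * slope h + (2 * rho)^-1 * (h^-1 * rem h)
    @[h --> 0^'] --> 2 * pospart s0 * dotp a q.
  have -> : 2 * pospart s0 * dotp a q =
      pospart s0 * (2 * dotp a q) + (2 * rho)^-1 * 0 by ring.
  by apply: cvgD; apply: cvgMl_tmp.
apply: cvg_trans lim_cvg; apply: near_eq_cvg; near=> h.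
by rewrite quotE//; near: h; exact: nbhs_dnbhs_neq.
Unshelve. all: by end_near. Qed.

(** * Accumulation points of the iterates *)

Lemma falm_penalty_run (R : realType) (m n : nat) (A : 'M[R]_(m, n))
    (b : 'cV[R]_m) (sigma : R) (P : 'cV[R]_n -> R) (xfeas : 'cV[R]_n)
    (gamma theta eta : R) (eps : nat -> R) (Upsilon : R)
    (Lmin Lmax tau c : R) (N : nat)
    (x : nat -> 'cV[R]_n) (mu rho : nat -> R) :
  (forall z, 0 <= P z) ->
  falm_generated A b sigma P xfeas gamma theta eta eps Upsilon
    Lmin Lmax tau c N x mu rho ->
  penalty_run sigma gamma theta eta Upsilon
    (fun k => enorm (A *m x k - b)) mu rho.
Proof.
move=> P0 [m0 r0 _ iter]; split=> // [k|k]; first exact: enorm_ge0.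
have [_ _ lag muE rhoE] := iter k; split=> //.
by apply: le_trans lag; rewrite muE lerDl.
Qed.

(** The distance is an infimum, possibly not attained, whence the factor 2 in
front of the positive tolerance. *)
Lemma falm_residual_subgradient (R : realType) (m n : nat) (A : 'M[R]_(m, n))
    (b : 'cV[R]_m) (sigma : R) (P : 'cV[R]_n -> R) (xfeas : 'cV[R]_n)
    (gamma theta eta : R) (eps : nat -> R) (Upsilon : R)
    (Lmin Lmax tau c : R) (N : nat)
    (x : nat -> 'cV[R]_n) (mu rho : nat -> R) (k : nat) :
  0 < rho k -> 0 < eps k ->
  falm_iteration A b sigma P xfeas gamma theta eta eps Upsilon
    Lmin Lmax tau c N x mu rho k ->
  exists2 v, limiting_subdiff P (x k.+1) v &
    `|(2 * mu k.+1) *: (A^T *m (A *m x k.+1 - b)) + v| <= 2 * eps k.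
Proof.
move=> r0 e0 [_ dist_le _ muE _].
have : (dist0 [set (gradient (wtilde A b sigma (mu k) (rho k)) (x k.+1) + v)%R
    | v in limiting_subdiff P (x k.+1)] < (2 * eps k)%:E)%E.
  by apply: le_lt_trans dist_le _; rewrite lte_fin ltr_pMl// ltr1n.
move=> /ereal_inf_lt[_ [_ [v vP <-] <-]]; rewrite lte_fin => small.
exists v => //; rewrite muE -gradient_wtilde//.
exact: le_trans (norm_le_enorm _) (ltW small).
Qed.

Theorem theorem5p7 (R : realType) (m n : nat) (A : 'M[R]_(m, n))
    (b : 'cV[R]_m) (sigma : R) (r : nat) (phi : R -> R) (xfeas : 'cV[R]_n)
    (gamma theta eta : R) (eps : nat -> R) (Upsilon : R)
    (Lmin Lmax tau c : R) (N : nat)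
    (x : nat -> 'cV[R]_n) (mu rho : nat -> R) (xs : 'cV[R]_n)
    (sigma_ge0 : 0 <= sigma) (r_lt_n : (r < n)%N)
    (phi_cont : {within `[0, +oo[, continuous phi})
    (phi_incr : {in `[0, +oo[ &, {homo phi : s t / s <= t}})
    (phi0 : phi 0 = 0)
    (xfeas_feasible : enorm (A *m xfeas - b) <= sigma)
    (gamma_gt1 : 1 < gamma) (theta_gt0 : 0 < theta) (eta01 : 0 < eta < 1)
    (eps_gt0 : forall k, 0 < eps k) (eps_decr : nonincreasing_seq eps)
    (eps_cvg0 : eps k @[k --> \oo] --> 0)
    (Lmin_gt0 : 0 < Lmin) (Lmin_lt_Lmax : Lmin < Lmax)
    (tau_gt1 : 1 < tau) (c_gt0 : 0 < c)
    (x_generated : falm_generated A b sigma (Phi phi r) xfeas gamma theta eta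
                     eps Upsilon Lmin Lmax tau c N x mu rho)
    (xs_accumulation : cluster (x k @[k --> \oo]) xs) :
  enorm (A *m xs - b) <= sigma /\
  (horizon_subdiff (Phi phi r) xs `&`
     [set t *: (A^T *m (b - A *m xs)) | t in [set t : R | 0 <= t]] = [set 0] ->
   (enorm (A *m xs - b) = sigma -> A^T *m (A *m xs - b) <> 0) ->
   first_order_stationary A b sigma (Phi phi r) xs).
Proof.
have run := falm_penalty_run (fun z => Phi_ge0 r z phi_incr phi0) x_generated.
have [_ _ _ iter] := x_generated.
have mu0 := run_mu_ge0 run.
have [f foo zxs] := cluster_subsequence xs_accumulation.
have res_cvg : A *m x (f k).+1 - b @[k --> \oo] --> A *m xs - b.
  by apply: cvgB; [exact: cvg_mulmx|exact: cvg_cst].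
have e_cvg : enorm (A *m x (f k).+1 - b) @[k --> \oo] --> enorm (A *m xs - b).
  exact: cvg_enorm.
have feas : enorm (A *m xs - b) <= sigma.
  have viol0 : violation sigma (enorm (A *m x (f k).+1 - b)) @[k --> \oo] --> 0.
    have := run_violation_cvg0 sigma_ge0 eta01 gamma_gt1 run.
    rewrite -cvg_shiftS; exact: (cvg_comp _ _ foo).
  rewrite -subr_le0; apply: ler_cvg_to viol0 _; last first.
    by apply: nearW => k; exact: pospart_ge.
  by apply: cvgB => //; exact: cvg_cst.
split=> // hor qual.
have /choice[v hv] k : exists v, limiting_subdiff (Phi phi r) (x (f k).+1) v /\
    `|(2 * mu (f k).+1) *: (A^T *m (A *m x (f k).+1 - b)) + v| <= 2 * eps (f k).
  have /andP[rho_gt0 _] := run_rho_step gamma_gt1 run (f k).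
  have [v vP small] :=
    falm_residual_subgradient rho_gt0 (eps_gt0 _) (iter (f k)).
  by exists v.
have vP k : limiting_subdiff (Phi phi r) (x (f k).+1) (v k) by have [] := hv k.
have kkt_cvg : (2 * mu (f k).+1) *: (A^T *m (A *m x (f k).+1 - b)) + v k
    @[k --> \oo] --> (0 : 'cV[R]_n).
  apply/norm_cvg0P.
  apply: (@squeeze_cvgr _ _ _ _ (cst 0) (fun k => 2 * eps (f k))).
  - by apply: nearW => k; rewrite normr_ge0; have [] := hv k.
  - exact: cvg_cst.
  - rewrite -[X in _ --> X](mulr0 (2 : R)); apply: cvgMl_tmp.
    exact: (cvg_comp _ _ foo eps_cvg0).
have Phi_cvg : Phi phi r (x (f k).+1) @[k --> \oo] --> Phi phi r xs.
  exact: (cvg_comp _ _ zxs (@Phi_continuous _ _ _ r phi_cont xs)).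
have [active|inactive] := eqVneq (enorm (A *m xs - b)) sigma.
  have g_cvg :
      A^T *m (A *m x (f k).+1 - b) @[k --> \oo] --> A^T *m (A *m xs - b).
    exact: cvg_mulmx.
  have m0 k : 0 <= 2 * mu (f k).+1 by rewrite mulr_ge0.
  have [[ms ms0 msP]|horP] :=
    multiplier_dichotomy zxs Phi_cvg g_cvg m0 vP kkt_cvg.
    (* [ms] is the limit of the doubled multipliers [2 * mu]. *)
    exists (ms / 2); split=> //; first by rewrite divr_ge0.
      exists (- (ms *: (A^T *m (A *m xs - b)))) => //.
      by rewrite mulrCA divff ?mulr1 ?subrr// pnatr_eq0.
    by rewrite active subrr mulr0.
  have : [set 0] (- (A^T *m (A *m xs - b))).
    rewrite -hor; split=> //=; exists 1 => //.
    by rewrite scale1r -[b - _]opprB mulmxN.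
  move=> /eqP; rewrite oppr_eq0 => /eqP g0; by case: (qual active).
have slack : 0 <= enorm (A *m xs - b) < sigma.
  by rewrite enorm_ge0 lt_neqAle inactive.
have mu_zero := run_inactive_multiplier sigma_ge0 eta01 gamma_gt1 theta_gt0 run
  foo e_cvg slack.
exists 0; split=> //; last by rewrite mul0r.
exists 0; last by rewrite mulr0 scale0r addr0.
apply: limiting_subdiff_closed zxs Phi_cvg vP _.
apply: cvg_trans kkt_cvg; apply: near_eq_cvg.
by apply: filterS mu_zero => k ->; rewrite mulr0 scale0r add0r.
Qed.
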